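(* Let $G$ be a finite group, $p$ a prime, and $P$ a Sylow $p$-subgroup of $G$. If $\eta(P)$ is weakly closed in $P$ with respect to $G$, then $P\cap G' = P\cap N_G(\eta(P))'$.
   Context: For a finite $p$-group $P$, a normal subgroup $N$ of $P$ is powerfully embedded in $P$ if $[N,P]\le N^p$ when $p$ is odd, and $[N,P]\le N^4$ when $p=2$ (here $N^{k}$ denotes the subgroup generated by all $k$-th powers of elements of $N$). $\eta(P)$ denotes the largest powerfully embedded subgroup of $P$, i.e. the product of all powerfully embedded subgroups of $P$ (it is itself powerfully embedded and characteristic in $P$). A subgroup $W\le P$ is weakly closed in $P$ with respect to $G$ if for every $g\in G$ with $W^g\le P$ one has $W^g=W$. $X'$ denotes the derived subgroup of $X$. *)

(* Defs.v *)
From mathcomp Require Import all_boot all_fingroup all_solvable.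
Set Implicit Arguments. Unset Strict Implicit. Unset Printing Implicit Defensive.
Import GroupScope.
Local Open Scope group_scope.

Section Defs.
Variable gT : finGroupType.

Definition pow_subgroup (N : {set gT}) (k : nat) : {set gT} :=
  <<[set x ^+ k | x in N]>>.

Definition powerfully_embedded (p : nat) (N P : {set gT}) : bool :=
  (N <| P) && ([~: N, P] \subset pow_subgroup N (if p == 2 then 4 else p)).

Definition eta (p : nat) (P : {set gT}) : {set gT} :=
  <<\bigcup_(N : {group gT} | powerfully_embedded p N P) N>>.

Definition weakly_closed (W P G : {set gT}) : Prop :=
  forall g, g \in G -> W :^ g \subset P -> W :^ g = W.
End Defs.

(* Main.v *)
(* Write N = N_G(W) with W = eta(P), and let lam be a homomorphism from N to an
   elementary abelian p-group. If x in P has minimal order subject to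
   lam x <> 0, then the transfer of lam to G takes the value lam x at x. Indeed
   x fixes the trivial coset of N, which is the only one fixed by W because W is
   weakly closed. The other cosets split into nontrivial W-orbits, permuted by
   P, so it suffices that a power y of x stabilizing such an orbit C
   contributes 0 on C. Let S be the stabilizer of C in P and R a maximal
   subgroup of S containing the stabilizer of a point of C. If y is not in R,
   then y permutes the p R-orbits of C cyclically and only elements of smaller
   order contribute. If y is in R, the contribution is a norm
   sum_(i < p) mu (y ^ (w ^ i)) with w in W \ R, and this is
   p mu(y) + 'C(p, 2) mu([y, w]) because [W, P] <= W^p; it vanishes for odd p,
   and also for p = 2 because then [W, P] <= W^4.
   Hence the transfer of the largest abelian p-quotient of N maps P onto that
   quotient, so by counting its kernel in P is P :&: N', and it contains
   P :&: G'. *)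
Require Import Defs.
From mathcomp Require Import all_boot all_fingroup all_solvable.
From mathcomp Require Import ssralg.
Set Implicit Arguments.
Unset Strict Implicit.
Unset Printing Implicit Defensive.
Import GroupScope GRing.Theory.
Local Open Scope group_scope.

(* Transfer is the sum of a cocycle over an invariant set. Summing a cocycle
   over subsets gives a cocycle for the induced action on subsets, which
   replaces both the Mackey formula and the transitivity of transfer. *)
Definition cocycle (gT : finGroupType) (X : finType) (A : zmodType)
    (to : {action gT &-> X}) (G : {set gT}) (D : {set X}) (c : X -> gT -> A) :=
  forall u g h, u \in D -> g \in G -> h \in G ->
    c u (g * h) = (c u g + c (to u g) h)%R.

Definition csum (gT : finGroupType) (X : finType) (A : zmodType)
    (c : X -> gT -> A) (Y : {set X}) (g : gT) : A := (\sum_(u in Y) c u g)%R.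

Lemma acts_subsets (gT : finGroupType) (X : finType) (to : {action gT &-> X})
    (G : {set gT}) (D : {set X}) :
  [acts G, on D | to] -> [acts G, on powerset D | to^*].
Proof.
move=> actGD; apply/actsP=> g Gg Y; rewrite !powersetE.
rewrite -{1}(astabs_setact (subsetP actGD _ Gg)).
apply/idP/idP=> [/subsetP sY|]; last exact: imsetS.
apply/subsetP=> y Yy.
by have /imsetP[z Dz /act_inj->] := sY _ (imset_f (to^~ g) Yy).
Qed.

(** * Cocycles of a group action and their sums over orbits and invariant sets *)

Section Cocycle.
Variables (gT : finGroupType) (X : finType) (A : zmodType).
Variables (to : {action gT &-> X}) (G : {group gT}) (D : {set X}).
Variable c : X -> gT -> A.
Hypotheses (actGD : [acts G, on D | to]) (cM : cocycle to G D c).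

Lemma cocycle_csum : cocycle to^* G (powerset D) (csum c).
Proof.
move=> Y g h; rewrite powersetE => /subsetP sYD Gg Gh.
rewrite /csum /= big_imset /=; last by move=> u v _ _ /act_inj.
by rewrite -big_split; apply: eq_bigr => u /sYD Du; rewrite cM.
Qed.

Lemma cocycle1 u : u \in D -> c u 1 = 0%R.
Proof.
move=> Du; have:= cM Du (group1 G) (group1 G).
by rewrite act1 mulg1 => /eqP;
   rewrite -[X in X == _]addr0 (inj_eq (addrI _)) => /eqP.
Qed.

Lemma cocycleX u g n : u \in D -> g \in G ->
  c u (g ^+ n) = (\sum_(i < n) c (to u (g ^+ i)%g) g)%R.
Proof.
move=> Du Gg; elim: n => [|n IHn]; first by rewrite big_ord0 cocycle1.
by rewrite expgSr cM ?groupX // IHn big_ord_recr.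
Qed.

(** The cocycle law telescopes around a cycle of [g]. For cosets this is the usual evaluation of
    transfer on the cycles of an element. *)
Lemma cocycle_orbit u g : u \in D -> g \in G ->
  let n := #|orbit to <[g]> u| in
  (\sum_(v in orbit to <[g]> u) c v g)%R = c u (g ^+ n) /\ to u (g ^+ n) = u.
Proof.
move=> Du Gg n; pose s := actperm to g.
have sX i : iter i s u = to u (g ^+ i).
  by rewrite -permX -morphX ?inE //= actpermE.
have orbE : orbit to <[g]> u = porbit s u by rewrite porbit_actperm ?inE.
rewrite {}/n orbE; split; last by rewrite -sX iter_porbit.
rewrite cocycleX // (eq_bigl _ _ (porbit_traject s u)).
rewrite -big_uniq ?uniq_traject_porbit //= (big_nth u) size_traject big_mkord.
by apply: eq_bigr => i _; rewrite nth_traject // sX.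
Qed.

(** By the cycle formula, only values at powers that fix a point matter. The points will be cosets,
    [R]-orbits of cosets or [W]-orbits of cosets. *)
Lemma cocycle_vanish (Y : {set X}) g : Y \subset D -> g \in G -> to^* Y g = Y ->
  (forall u n, u \in Y -> to u (g ^+ n) = u -> c u (g ^+ n) = 0%R) ->
  csum c Y g = 0%R.
Proof.
move=> sYD Gg Yg c0; have actgY : [acts <[g]>, on Y | to].
  by rewrite -astab1_set cycle_subG; apply/astab1P.
rewrite /csum (set_partition_big _ (orbit_partition actgY)) big1 //=.
move=> _ /imsetP[u Yu ->]; have Du := subsetP sYD u Yu.
have [-> fixu] := cocycle_orbit Du Gg; exact: c0.
Qed.

Lemma csumM (Y : {set X}) : Y \in powerset D ->
    (forall g, g \in G -> to^* Y g = Y) ->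
  {in G &, forall g h, csum c Y (g * h) = (csum c Y g + csum c Y h)%R}.
Proof.
by move=> DY fixY g h Gg Gh; rewrite (cocycle_csum DY Gg Gh) /= fixY.
Qed.

(** Expanding [c u (h * g * h^-1)] leaves the wanted term plus [c u h] and [c (to u h) h^-1], which
    add up to [c u 1]. *)
Lemma cocycleJ u g h : u \in D -> g \in G -> h \in G ->
    to (to u h) g = to u h ->
  c (to u h) g = c u (g ^ h^-1).
Proof.
move=> Du Gg Gh fixg; have Duh : to u h \in D by rewrite (actsP actGD).
rewrite /conjg invgK !cM ?groupM ?groupV // fixg addrCA -cM ?groupV //.
by rewrite mulgV cocycle1 ?addr0.
Qed.

End Cocycle.

(** * Norm sums over a normal subgroup of prime index *)

Section NormMap.
Variables (gT : finGroupType) (A : zmodType) (p : nat) (R S W : {group gT}).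
Variable mu : gT -> A.
Hypotheses (p_pr : prime p) (nsRS : R <| S) (indR : #|S : R| = p).
Hypotheses (sWS : W \subset S) (pA : forall v : A, (v *+ p = 0)%R).
Hypothesis muM : {in R &, forall x y, mu (x * y) = (mu x + mu y)%R}.

Lemma prime_index_expg u : u \in S -> u ^+ p \in R.
Proof.
move=> Su; have nRu : u \in 'N(R) by apply: (subsetP (normal_norm nsRS)).
apply: coset_idr; rewrite ?groupX // morphX // -indR.
rewrite -card_quotient ?normal_norm //.
by rewrite expg_cardG ?mem_quotient.
Qed.

Lemma prime_index_mul u : u \in S -> u \notin R -> R * <[u]> = S.
Proof.
move=> Su Ru; apply: mulg_normal_maximal; rewrite ?cycle_subG //.
by apply: p_index_maximal; rewrite ?indR ?normal_sub.
Qed.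

Lemma prime_index_dvdn u n : u \in S -> u \notin R -> u ^+ n \in R -> p %| n.
Proof.
move=> Su R'u Run.
have nRu : u \in 'N(R) by apply: (subsetP (normal_norm nsRS)).
have <- : #[coset R u] = p.
  apply/prime_nt_dvdP => //.
    by rewrite order_eq1; apply: contra R'u => /eqP; apply: coset_idr.
  by rewrite order_dvdn -morphX //= coset_id // prime_index_expg.
by rewrite order_dvdn -morphX //= coset_id.
Qed.

Lemma add_morph1 : mu 1 = 0%R.
Proof.
have:= muM (group1 R) (group1 R).
by rewrite mulg1 => /eqP;
   rewrite -[X in X == _]addr0 (inj_eq (addrI _)) => /eqP.
Qed.

Lemma add_morphX x n : x \in R -> mu (x ^+ n) = (mu x *+ n)%R.
Proof.
move=> Rx; elim: n => [|n IHn]; first exact: add_morph1.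
by rewrite expgS mulrS muM ?groupX // IHn.
Qed.

Lemma add_morphJ x y : x \in R -> y \in R -> mu (x ^ y) = mu x.
Proof.
move=> Rx Ry; apply: (addrI (mu y)).
by rewrite -!muM ?groupJ // conjgE mulKVg !muM // addrC.
Qed.

(* If u lies outside R then w = r u^j with r in R, so conjugation by w acts on
   u^p modulo R' as conjugation by u^j does, that is trivially. *)
Lemma add_morph_powJ w : w \in W ->
  {in pow_subgroup W p, forall v, v \in R /\ mu (v ^ w) = mu v}.
Proof.
move=> Ww; have Sw := subsetP sWS w Ww.
have nRw : w \in 'N(R) by apply: (subsetP (normal_norm nsRS)).
have gK : group_set [set v in R | mu (v ^ w) == mu v].
  apply/group_setP; split=> [|x y]; first by rewrite inE group1 conj1g eqxx.
  rewrite !inE => /andP[Rx /eqP mux] /andP[Ry /eqP muy].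
  rewrite groupM // conjMg [mu (x * y)]muM //.
  by rewrite ?[mu (_ ^ w * _)]muM ?memJ_norm // mux muy eqxx.
suff sK : pow_subgroup W p \subset Group gK.
  by move=> v /(subsetP sK); rewrite inE => /andP[-> /eqP].
rewrite gen_subG; apply/subsetP=> _ /imsetP[u Wu ->].
have Su := subsetP sWS u Wu; rewrite inE prime_index_expg //=.
have [Ru | R'u] := boolP (u \in R).
  by rewrite conjXg !add_morphX ?memJ_norm // !pA.
have: w \in R * <[u]> by rewrite prime_index_mul.
case/mulsgP=> r _ Rr /cycleP[j ->] ->; rewrite conjgM.
have nRu : u ^+ j \in 'N(R) by rewrite groupX // (subsetP (normal_norm nsRS)).
rewrite conjJg (_ : (u ^+ p) ^ (u ^+ j) = u ^+ p).
  by rewrite add_morphJ ?memJ_norm // prime_index_expg.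
by apply/conjg_fixP/commgP/commuteX2; apply: commute_refl.
Qed.

(* Since mu (v ^ w) = mu v on W^p, one gets
   mu (y ^ (w ^+ i)) = mu y + i mu [~ y, w], and the i add up to 'C(p, 2). *)
Lemma norm_vanish y w :
    [~: W, S] \subset pow_subgroup W (if p == 2 then 4 else p) ->
  y \in R -> w \in W -> (\sum_(i < p) mu (y ^ (w ^+ i)%g) = 0)%R.
Proof.
move=> sWS' Ry Ww; have Sw := subsetP sWS w Ww.
have Sy := subsetP (normal_sub nsRS) y Ry.
have nRw : w \in 'N(R) by apply: (subsetP (normal_norm nsRS)).
have ywW : [~ y, w] \in pow_subgroup W (if p == 2 then 4 else p).
  by rewrite (subsetP sWS') // commGC mem_commg.
have sW4 : pow_subgroup W (if p == 2 then 4 else p) \subset pow_subgroup W p.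
  case: eqP => // ->; rewrite gen_subG; apply/subsetP=> _ /imsetP[u Wu ->].
  by apply/mem_gen/imsetP; exists (u ^+ 2); rewrite ?groupX // -expgM.
have [Ryw _] := add_morph_powJ Ww (subsetP sW4 _ ywW).
have muJ i : mu ([~ y, w] ^ (w ^+ i)) = mu [~ y, w].
  by have [] := add_morph_powJ (groupX i Ww) (subsetP sW4 _ ywW).
have muy i : mu (y ^ (w ^+ i)) = (mu y + mu [~ y, w] *+ i)%R.
  elim: i => [|i IHi]; first by rewrite conjg1 addr0.
  have ->: y ^ (w ^+ i.+1) = y ^ (w ^+ i) * [~ y, w] ^ (w ^+ i).
    by rewrite -conjMg commgEl mulKVg -conjgM -expgS.
  by rewrite muM ?memJ_norm ?groupX // IHi muJ mulrSr addrA.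
under eq_bigr do rewrite muy.
rewrite big_split /= sumr_const card_ord pA add0r sumrMnr.
have [p2 | p'2] := eqVneq p 2; last first.
  have /dvdnP[m ->]: p %| \sum_(i < p) i.
    rewrite -(big_mkord xpredT id) bin2_sum prime_dvd_bin //=.
    by rewrite [2 < p]ltn_neqAle eq_sym p'2 prime_gt1.
  by rewrite mulrnA pA.
(* For [p = 2] the indices sum to 1, so the commutator term itself must vanish. It does because
   [u ^+ 4] is the square of [u ^+ 2], an element of [R]. *)
suff ->: mu [~ y, w] = 0%R by rewrite mul0rn.
have gK : group_set [set v in R | mu v == 0%R].
  apply/group_setP; split=> [|x z]; first by rewrite inE group1 add_morph1 eqxx.
  rewrite !inE => /andP[Rx /eqP mux] /andP[Rz /eqP muz].
  by rewrite groupM // muM // mux muz addr0 eqxx.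
rewrite p2 /= in ywW.
suff /subsetP/(_ _ ywW) : pow_subgroup W 4 \subset Group gK.
  by rewrite inE => /andP[_ /eqP].
rewrite gen_subG; apply/subsetP=> _ /imsetP[u Wu ->].
have Ru2 : u ^+ 2 \in R by rewrite -p2 prime_index_expg // (subsetP sWS).
by rewrite inE (expgM u 2 2) groupX //= add_morphX // -p2 pA.
Qed.

End NormMap.

Lemma cocycleS (gT : finGroupType) (X : finType) (A : zmodType)
    (to : {action gT &-> X}) (G H : {group gT}) (D : {set X})
    (c : X -> gT -> A) :
  H \subset G -> cocycle to G D c -> cocycle to H D c.
Proof. by move=> /subsetP sHG cM u g h Du Hg Hh; rewrite cM ?sHG. Qed.

(** * Transfer as the sum of a cocycle on right cosets *)

(** With [repr] as transversal, this is the factor of the transfer of [lam] at the coset [u]. *)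
Definition coset_cocycle (gT : finGroupType) (A : zmodType) (lam : gT -> A)
  (u : {set gT}) (g : gT) : A := lam (repr u * g * (repr (u :* g))^-1).

Section CosetCocycle.
Variables (gT : finGroupType) (A : zmodType) (G H : {group gT}) (lam : gT -> A).
Hypothesis lamM : {in H &, forall x y, lam (x * y) = (lam x + lam y)%R}.

Lemma coset_cocycleP : cocycle 'Rs G (rcosets H G) (coset_cocycle lam).
Proof.
move=> _ g h /rcosetsP[x Gx ->] Gg Gh /=; rewrite /coset_cocycle !rcosetE.
rewrite -!rcosetM -lamM -?mem_rcoset; first by rewrite !mulgA mulgKV.
  by rewrite rcoset_repr rcosetM mem_rcoset mulgK mem_repr_rcoset.
by rewrite rcoset_repr (rcosetM _ _ h) mem_rcoset mulgK mem_repr_rcoset.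
Qed.

Lemma coset_cocycle_fix u g : u \in rcosets H G -> 'Rs%act u g = u ->
  g ^ (repr u)^-1 \in H /\ coset_cocycle lam u g = lam (g ^ (repr u)^-1).
Proof.
move=> /rcosetsP[x Gx ->]; rewrite /coset_cocycle /= !rcosetE => fixg.
rewrite fixg -mulgA conjgE invgK; split=> //; rewrite mulgA -mem_rcoset.
by rewrite rcoset_repr -{2}fixg mem_rcoset mulgK mem_repr_rcoset.
Qed.

End CosetCocycle.

(** * The transfer at an element of minimal order *)

Section BlockTransfer.
Variables (gT : finGroupType) (A : zmodType) (p : nat) (G P W : {group gT}).
Variables (lam : gT -> A) (x : gT).
Local Notation N := 'N_G(W).
Local Notation D := (rcosets N G).
Local Notation c := (coset_cocycle lam).
Local Notation to := ('Rs)%act.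
Hypotheses (p_pr : prime p) (sylP : p.-Sylow(G) P).
Hypotheses (embW : powerfully_embedded p W P) (wcW : weakly_closed W P G).
Hypothesis pA : forall v : A, (v *+ p = 0)%R.
Hypothesis lamM : {in N &, forall y z, lam (y * z) = (lam y + lam z)%R}.
Hypothesis Px : x \in P.
Hypothesis min_x : forall z, z \in N -> #[z] < #[x] -> lam z = 0%R.

Let sPG : P \subset G := pHall_sub sylP.
Let pP : p.-group P := pHall_pgroup sylP.
Let sWP : W \subset P. Proof. by case/andP: embW => /normal_sub. Qed.
Let nWP : P \subset 'N(W). Proof. by case/andP: embW => /normal_norm. Qed.
Let sNG : N \subset G. Proof. exact: subsetIl. Qed.
Let sPN : P \subset N. Proof. by rewrite subsetI sPG. Qed.
Let actGD : [acts G, on D | to]. Proof. exact: actsRs_rcosets. Qed.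
Let cM : cocycle to G D c. Proof. exact: coset_cocycleP. Qed.
Let cM2 : cocycle to^* G (powerset D) (csum c).
Proof. exact: cocycle_csum. Qed.
Let actGD2 : [acts G, on powerset D | to^*]. Proof. exact: acts_subsets. Qed.

(** Each contribution is [lam] at a conjugate of a power of [y], of order below that of [x]. *)
Lemma csum_small (Y : {set {set gT}}) y : Y \subset D -> y \in G ->
  to^* Y y = Y -> #[y] < #[x] -> csum c Y y = 0%R.
Proof.
move=> sYD Gy Yy lt_yx; apply: (cocycle_vanish cM) => // u n Yu fixu.
have [Nz ->] := coset_cocycle_fix lam (subsetP sYD u Yu) fixu.
apply: min_x => //; rewrite orderJ; apply: leq_ltn_trans lt_yx.
by rewrite dvdn_leq ?orderXdvd.
Qed.

Lemma block_vanish u0 y : u0 \in D -> u0 \notin 'Fix_to(W) -> y \in P ->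
  to^* (orbit to W u0) y = orbit to W u0 -> #[y] <= #[x] ->
  csum c (orbit to W u0) y = 0%R.
Proof.
move=> Du0 nfixW Py Cy le_yx; set C := orbit to W u0.
(* S is the stabilizer of C in P. *)
pose Q := 'C_P[u0 | to]%G; pose S := (Q <*> W)%G.
have nWQ : Q \subset 'N(W) := subset_trans (subsetIl _ _) nWP.
have defS : S = Q * W :> {set gT} by apply: norm_joinEl.
have sSP : S \subset P by rewrite join_subG subsetIl.
have sSG := subset_trans sSP sPG.
have sWS : W \subset S := joing_subr Q W.
have sQS : Q \subset S := joing_subl Q W.
have pS := pgroupS sSP pP.
have sCD : C \subset D.
  by rewrite acts_sub_orbit ?(subset_trans sWP) // (subset_trans sPG).
(* [W] is transitive on [C], so [y] agrees at [u0] with some element of [W] and differs from it by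
   an element of [Q]. *)
have Sy : y \in S.
  have /orbitP[w Ww eq_w] : to u0 y \in C.
    by rewrite -[C]Cy mem_setact ?orbit_refl.
  have Qyw : y * w^-1 \in Q.
    rewrite inE groupM ?groupV ?(subsetP sWP w Ww) //=.
    by apply/astab1P; rewrite actM -eq_w actK.
  by rewrite -(mulgKV w y) groupM ?(subsetP sQS _ Qyw) ?(subsetP sWS).
have sWQ : ~~ (W \subset Q).
  apply: contra nfixW => /subsetP sWQ; apply/afixP=> b /sWQ.
  by rewrite inE => /andP[_ /astab1P].
have [eqQS | [R maxR sQR]] := maximal_exists sQS.
  by rewrite eqQS sWS in sWQ.
have nsRS := p_maximal_normal pS maxR; have indR := p_maximal_index pS maxR.
have sRS := normal_sub nsRS; have nRS := normal_norm nsRS.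
have sRP := subset_trans sRS sSP; have sRG := subset_trans sRS sSG.
have /subsetPn[w Ww R'w] : ~~ (W \subset R).
  apply: contraL (maxgroupp maxR) => sWR.
  by rewrite properE negb_and negbK join_subG sQR sWR orbT.
have CS s : s \in S -> to u0 s \in C.
  rewrite /= defS => /mulsgP[q v /setIP[_ /astab1P fixq] Wv ->].
  by rewrite actM fixq mem_orbit.
have CJ s : s \in S -> to^* C s = C.
  move=> Ss; have nWs : s \in 'N(W) by rewrite (subsetP nWP) ?(subsetP sSP).
  by rewrite setact_orbit (normP nWs); apply/orbit_eqP/CS.
have actRC : [acts R, on C | to].
  by rewrite -astab1_set; apply/subsetP=> r Rr; apply/astab1P/CJ/(subsetP sRS).
pose bl u := orbit to R u; pose BB := bl @: C.
have blJ u s : s \in S -> to^* (bl u) s = bl (to u s).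
  by move=> Ss; rewrite setact_orbit (normP (subsetP nRS s Ss)).
have sumC z : csum c C z = csum (csum c) BB z.
  by rewrite /csum (set_partition_big _ (orbit_partition actRC)).
have sBBD : BB \subset powerset D.
  apply/subsetP=> _ /imsetP[u Cu ->]; rewrite powersetE.
  by rewrite (subset_trans _ sCD) // acts_sub_orbit.
(* Since [Q] lies in [R], an element of [S] that stabilizes the [R]-orbit of [u0] lies in [R];
   conjugation extends this to all blocks in [stab]. *)
have stab0 s : s \in S -> bl (to u0 s) = bl u0 -> s \in R.
  move=> Ss /orbit_eqP/orbitP[r Rr eq_r].
  have Qsr : s * r^-1 \in Q.
    rewrite inE groupM ?groupV ?(subsetP sSP _ Ss) ?(subsetP sRP _ Rr) //=.
    by apply/astab1P; rewrite actM -eq_r actK.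
  by rewrite -(mulgKV r s); apply: groupM (subsetP sQR _ Qsr) Rr.
have Cw u : u \in C -> exists2 t, t \in S & u = to u0 t.
  by case/orbitP=> t Wt <-; exists t; rewrite // (subsetP sWS).
have stab u s : u \in C -> s \in S -> to^* (bl u) s = bl u -> s \in R.
  case/Cw=> t St -> Ss; rewrite blJ // => eq_bl.
  have nRt : t^-1 \in 'N(R) by rewrite groupV (subsetP nRS).
  rewrite -(memJ_norm _ nRt); apply: stab0; first by rewrite groupJ ?groupV.
  rewrite conjgE invgK !actM -blJ ?groupV // eq_bl blJ ?groupV //.
  by rewrite actK.
have blR u r : u \in C -> r \in R -> bl (to u r) = bl u.
  by move=> Cu Rr; apply/orbit_eqP/mem_orbit.
have u0C : u0 \in C by apply: orbit_refl.
(* Outside [R], a power of [y] stabilizing a block has exponent divisible by [p], hence order below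
   that of [y], and [csum_small] applies. *)
have [Ry | R'y] := boolP (y \in R); last first.
  rewrite sumC; apply: (cocycle_vanish cM2) => //; first exact: (subsetP sPG).
    rewrite /BB -{2}(CJ y Sy) !setactE -!imset_comp.
    by apply: eq_imset => u; apply: blJ.
  move=> _ n /imsetP[u Cu ->] fixn.
  have Ryn := stab u _ Cu (groupX n Sy) fixn.
  have /dvdnP[m def_n] := prime_index_dvdn p_pr nsRS indR Sy R'y Ryn.
  apply: csum_small => //; first by rewrite -powersetE (subsetP sBBD) ?imset_f.
    by rewrite groupX ?(subsetP sPG).
  apply: leq_trans le_yx.
  have p_y : p %| #[y].
    have [//|_ pdvd _] := pgroup_pdiv (mem_p_elt pP Py) _ => //.
    by rewrite cycle_eq1; apply: contraNneq R'y => ->.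
  rewrite def_n mulnC expgM; apply: leq_ltn_trans (_ : #[y ^+ p] < _).
    by rewrite dvdn_leq ?orderXdvd.
  by rewrite orderXdiv // ltn_Pdiv ?prime_gt1.
have p_gt0 := prime_gt0 p_pr.
(* The blocks are the translates of [B] by powers of [w^-1]; the inverse makes [cocycleJ] produce
   the conjugates [y ^ (w ^+ i)] of the norm sum. *)
pose B := bl u0; pose f (i : 'I_p) := to^* B (w^-1 ^+ i).
have Sw := subsetP sWS w Ww.
have SwX i : w^-1 ^+ i \in S by rewrite groupX ?groupV.
have injf : injective f.
  suff injf (i j : 'I_p) : i <= j -> f i = f j -> i = j.
    move=> i j eqf; case/orP: (leq_total i j) => [|le_ji].
      by move/injf; apply.
    by apply/esym/injf.
  move=> le_ij eqf; apply/val_inj/eqP; rewrite eqn_leq le_ij /= -subn_eq0.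
  have R'v : w^-1 \notin R by rewrite groupV.
  have Sv : w^-1 \in S by rewrite groupV.
  have: w^-1 ^+ (j - i) \in R.
    apply: stab0 => //; rewrite -blJ //; apply: (act_inj (to^*) (w^-1 ^+ i)).
    by rewrite -actM -expgD subnK.
  move/(prime_index_dvdn p_pr nsRS indR Sv R'v).
  by apply: contraLR => nz;
     rewrite gtnNdvd ?lt0n // (leq_ltn_trans (leq_subr _ _)).
have defBB : BB = [set f i | i in 'I_p].
  apply/setP=> E; apply/imsetP/imsetP=> [[u /Cw[t St ->] ->] | [i _ ->]].
    have R'v : w^-1 \notin R by rewrite groupV.
    have Sv : w^-1 \in S by rewrite groupV.
    have: t \in R * <[w^-1]> by rewrite (prime_index_mul p_pr nsRS indR Sv R'v).
    case/mulsgP=> r _ Rr /cycleP[i ->] ->.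
    exists (Ordinal (ltn_pmod i p_gt0)); rewrite //.
    rewrite (_ : f _ = bl (to u0 (w^-1 ^+ (i %% p)))); last exact: blJ.
    rewrite actM -[LHS]blJ // (blR u0 r) // blJ // {1}(divn_eq i p) expgD actM.
    have Rvi : w^-1 ^+ (i %/ p * p) \in R.
      by rewrite mulnC expgM groupX // (prime_index_expg nsRS indR Sv).
    by rewrite -[LHS]blJ // (blR u0 _ _ Rvi) ?blJ.
  by exists (to u0 (w^-1 ^+ i)); rewrite ?CS // -blJ.
have BD : B \in powerset D by apply: (subsetP sBBD); apply: imset_f.
rewrite sumC {1}/csum defBB big_imset /=; last by move=> i j _ _; apply: injf.
have fixy i : to^* (to^* B (w^-1 ^+ i)) y = to^* B (w^-1 ^+ i).
  by rewrite /B !blJ // blR ?CS.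
rewrite (eq_bigr (fun i : 'I_p => csum c B (y ^ (w ^+ i)))); last first.
  move=> i _.
  have Gwi := subsetP sSG _ (SwX i).
  rewrite /f (cocycleJ actGD2 cM2 BD (subsetP sPG y Py) Gwi (fixy i)).
  by rewrite expgVn invgK.
have BR r : r \in R -> to^* B r = B.
  by move=> Rr; rewrite blJ ?blR ?(subsetP sRS).
(* Here [mu] is [csum c B], additive on [R] because [R] stabilizes [B]. *)
apply: (norm_vanish p_pr nsRS indR sWS pA _ _ Ry Ww).
  exact: (csumM (cocycleS sRG cM) BD BR).
by apply: subset_trans (commgS _ sSP) _; case/andP: embW.
Qed.
(** If [W] fixes the coset of [t], then [W :^ t^-1] lies in [N], and Sylow's theorem in [N]
    conjugates it into [P] by some [n]. Weak closure makes [t^-1 * n] normalize [W], so [t] is in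
    [N]. *)
Lemma fix_weakly_closed u : u \in D -> u \in 'Fix_to(W) -> u = N.
Proof.
case/rcosetsP=> t Gt -> /afixP fixW.
have sWN : W :^ t^-1 \subset N.
  apply/subsetP=> _ /imsetP[w Ww ->]; rewrite conjgE invgK mulgA -mem_rcoset.
  by rewrite -[in X in _ \in X](fixW w Ww) /= rcosetE -rcosetM rcoset_refl.
have sylPN : p.-Sylow(N) P := pHall_subl sPN sNG sylP.
have pWt : p.-group (W :^ t^-1) by rewrite pgroupJ; apply: pgroupS sWP pP.
have [n Nn] := Sylow_Jsub sylPN sWN pWt.
have Gtn : t^-1 * n \in G by rewrite groupM ?groupV ?(subsetP sNG n Nn).
rewrite -conjsgM => /(wcW Gtn)/normP nWtn.
by rewrite rcoset_id // -groupV -(mulgK n t^-1) groupM ?groupV // inE Gtn.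
Qed.

Lemma transfer_min_order : csum c D x = lam x.
Proof.
have DN : (N : {set gT}) \in D by apply/rcosetsP; exists 1; rewrite ?rcoset1.
have fixN y : y \in N -> to (N : {set gT}) y = N.
  by move=> Ny; rewrite /= rcosetE rcoset_id.
have cN : c (N : {set gT}) x = lam x.
  have [_ ->] := coset_cocycle_fix lam DN (fixN x (subsetP sPN x Px)).
  by rewrite repr_group invg1 conjg1.
rewrite /csum (big_setD1 (N : {set gT})) //= cN -[RHS]addr0; congr (_ + _)%R.
set D' := D :\ _; have sD'D : D' \subset D by apply: subD1set.
have actPD' : [acts P, on D' | to].
  apply/actsP=> y Py u; rewrite !in_setD1 (actsP actGD) ?(subsetP sPG) //.
  congr (~~ _ && _); apply/eqP/eqP=> [eqN | ->]; last first.
    by rewrite fixN ?(subsetP sPN).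
  by apply: (act_inj to y); rewrite eqN fixN ?(subsetP sPN).
have actWD' : [acts W, on D' | to] := subset_trans sWP actPD'.
pose CC := [set orbit to W u | u in D'].
have sCCD : CC \subset powerset D.
  apply/subsetP=> _ /imsetP[u D'u ->]; rewrite powersetE.
  by rewrite (subset_trans _ sD'D) // acts_sub_orbit.
(* [P] normalizes [W], so [x] permutes the [W]-orbits, and only powers of [x] returning to an orbit
   need [block_vanish]. *)
rewrite (set_partition_big _ (orbit_partition actWD')) /=.
apply: (cocycle_vanish cM2 sCCD); first exact: (subsetP sPG).
  rewrite /CC -{2}(astabs_setact (subsetP actPD' x Px)) !setactE -!imset_comp.
  apply: eq_imset => u; rewrite /= -[LHS]/(to^* (orbit to W u) x) setact_orbit.
  by rewrite (normP (subsetP nWP x Px)).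
move=> _ n /imsetP[u D'u ->] fixC.
have [uN Du] := setD1P D'u.
apply: block_vanish => //; last by rewrite dvdn_leq ?orderXdvd.
  by apply: contra uN => /fix_weakly_closed->.
exact: groupX.
Qed.

End BlockTransfer.

(** * The subgroup [eta p P] is powerfully embedded *)

(** Modulo the subgroup [Z] generated by the [k]-th powers of [eta p P], each powerfully embedded
    [N] centralizes [P], hence so does the group they generate. *)
Lemma eta_powerfully_embedded (gT : finGroupType) (p : nat) (P : {group gT}) :
  powerfully_embedded p (eta p P) P.
Proof.
set k := if p == 2 then 4 else p.
have nEP : P \subset 'N(eta p P).
  rewrite norms_gen // norms_bigcup //; apply/bigcapsP=> N /andP[nsNP _].
  exact: normal_norm.
have sEP : eta p P \subset P.
  by rewrite gen_subG; apply/bigcupsP=> N /andP[/normal_sub].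
rewrite /powerfully_embedded /normal sEP nEP /= -/k.
rewrite -[pow_subgroup _ k]/(gval <<_>>%G); set Z := <<_>>%G.
have nZP : P \subset 'N(Z).
  rewrite norms_gen //; apply/subsetP=> x Px; rewrite inE.
  apply/subsetP=> _ /imsetP[_ /imsetP[u Eu ->] ->]; rewrite conjXg.
  by apply/imsetP; exists (u ^ x); rewrite // memJ_norm // (subsetP nEP).
have sEC : eta p P \subset coset Z @*^-1 'C(P / Z).
  rewrite [eta p P]/eta gen_subG; apply/bigcupsP=> N embN.
  have /andP[nsNP sNPN] := embN; have sNP := normal_sub nsNP.
  rewrite -sub_quotient_pre ?(subset_trans sNP) //.
  rewrite quotient_cents2 ?(subset_trans sNP) //.
  apply: subset_trans sNPN (genS (imsetS _ _)).
  by apply: sub_gen; apply: (@bigcup_sup _ _ N _ (@gval gT)) embN.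
have nZE := subset_trans sEP nZP.
by rewrite -quotient_cents2 ?sub_quotient_pre.
Qed.

(** * Surjectivity of the transfer on [P] and the comparison of kernels *)

Section FinalCount.
Variables (gT : finGroupType) (p : nat) (G P W : {group gT}).
Local Notation N := 'N_G(W).
Local Notation D := (rcosets N G).
Hypotheses (p_pr : prime p) (sylP : p.-Sylow(G) P).
Hypotheses (embW : powerfully_embedded p W P) (wcW : weakly_closed W P G).
Let sPG : P \subset G := pHall_sub sylP.
Let sNG : N \subset G. Proof. exact: subsetIl. Qed.
Let sPN : P \subset N.
Proof. by rewrite subsetI sPG; case/andP: embW => /normal_norm. Qed.
Let sylPN : p.-Sylow(N) P := pHall_subl sPN sNG sylP.

(** An element of least order is chosen within [P] only; Sylow's theorem in [N] extends its
    minimality to all of [N], as [transfer_min_order] requires. *)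
Lemma transfer_nonzero (A : zmodType) (lam : gT -> A) y :
    (forall v : A, (v *+ p = 0)%R) ->
    {in N &, forall y z, lam (y * z) = (lam y + lam z)%R} ->
  y \in P -> lam y != 0%R ->
  exists2 x, x \in P & csum (coset_cocycle lam) D x != 0%R.
Proof.
move=> pA lamM Py nz_y; pose good z := (z \in P) && (lam z != 0%R).
have gy : good y by apply/andP.
have [x /andP[Px nz_x] min_x] := arg_minnP (fun z : gT => #[z]) gy.
exists x => //.
rewrite (transfer_min_order p_pr sylP embW wcW pA lamM Px) // => z Nz lt_zx.
rewrite -(consttC p z) lamM ?groupX //.
(* The [p']-part is a [p]-th power in its own cyclic group, and [p] kills [A]. *)
have -> : lam z.`_p^' = 0%R.
  have co_p : coprime #|<[z.`_p^']>| p.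
    rewrite coprime_sym prime_coprime // -p'natE //; exact: p_elt_constt.
  rewrite -(expgK co_p (cycle_id _)) !(add_morphX lamM) ?groupX //.
  by rewrite pA mul0rn.
have pz : p.-group <[z.`_p]> by apply: p_elt_constt.
have szN : <[z.`_p]> \subset N by rewrite cycle_subG groupX.
have [n Nn] := Sylow_Jsub sylPN szN pz.
rewrite -cycleJ cycle_subG addr0 => Pzn.
apply: contraTeq lt_zx; rewrite -(add_morphJ lamM _ Nn) ?groupX // => nz.
have /min_x le_xz : good (z.`_p ^ n) by rewrite /good Pzn.
rewrite -leqNgt (leq_trans le_xz) //.
by rewrite orderJ dvdn_leq ?orderXdvd.
Qed.

(** [K] is the preimage of the [p']-core of the abelianization of [N]. An element of [P :&: K] maps
    there to both a [p]-element and a [p']-element, hence to 1. *)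
Lemma p_quotient_der1 : exists K : {group gT},
  [/\ K <| N, N^`(1) \subset K, p.-group (N / K) & P :&: K \subset N^`(1)].
Proof.
pose K := (coset N^`(1) @*^-1 'O_p^'(N / N^`(1)))%G.
have nsN'N : N^`(1) <| N by apply: der_normal.
have hallO : p^'.-Hall(N / N^`(1)) 'O_p^'(N / N^`(1)).
  by apply/nilpotent_pcore_Hall/abelian_nil/sub_der1_abelian.
have nsKN : K <| N.
  by rewrite -(quotientGK nsN'N) cosetpre_normal pcore_normal.
have sN'K : N^`(1) \subset K by apply: sub_cosetpre.
exists K; split=> //.
  rewrite -(isog_pgroup p (third_isog sN'K nsN'N nsKN)) cosetpreK.
  rewrite /pgroup card_quotient ?gFnorm // -pnatNK.
  by case/and3P: hallO.
apply/subsetP=> y /setIP[Py /morphpreP[nN'y Oy]].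
apply: coset_idr => //; apply/eqP; rewrite -order_eq1; apply/eqP.
apply: (@pnat_1 p); last exact: mem_p_elt (pcore_pgroup _ _) Oy.
by apply: morph_p_elt => //; apply: mem_p_elt (pHall_pgroup sylP) Py.
Qed.

Lemma focal_normalizer : P :&: G^`(1) = P :&: N^`(1).
Proof.
have [K [nsKN sN'K pNK sPKN']] := p_quotient_der1.
have abA : abelian (N / K) by apply: sub_der1_abelian.
have nKN := normal_norm nsKN; have nKP := subset_trans sPN nKN.
have defNK : P / K = N / K.
  apply: pHall_id pNK; exact: quotient_pHall.
pose phi y := FiniteModule.fmod abA (coset K y).
have phiM : {in N &, forall y z, phi (y * z) = (phi y + phi z)%R}.
  move=> y z Ny Nz; rewrite /phi morphM ?(subsetP nKN) //=.
  by rewrite FiniteModule.fmodM ?mem_quotient.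
pose v g := FiniteModule.fmval (csum (coset_cocycle phi) D g).
have DD : D \in powerset D by rewrite powersetE.
have fixD g : g \in G -> ('Rs)^* D g = D.
  by move=> Gg; apply: astabs_setact; apply: (subsetP (actsRs_rcosets _ _)).
have vM : {in G &, {morph v : g h / g * h}}.
  by move=> g h Gg Gh; rewrite /v (csumM (coset_cocycleP phiM) DD fixD).
pose vm := Morphism vM.
have vA g : v g \in N / K by apply: FiniteModule.fmodP.
have svPA : vm @* P \subset N / K.
  by apply/subsetP=> _ /morphimP[g _ _ ->].
have vP : vm @* P = N / K.
  (* Otherwise the image lies in a maximal subgroup [M]. Reducing modulo [M] gives a nonzero [lam]
     into a group of order [p] whose transfer vanishes on [P], against [transfer_nonzero]. *)
  have [//|[M maxM svM]] := maximal_exists svPA.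
  have nsM := p_maximal_normal pNK maxM; have indM := p_maximal_index pNK maxM.
  have abB : abelian (N / K / M) by apply: quotient_abelian.
  pose pi (u : FiniteModule.fmod_of abA) :=
    FiniteModule.fmod abB (coset M (FiniteModule.fmval u)).
  have piM (u1 u2 : FiniteModule.fmod_of abA) :
      pi (u1 + u2)%R = (pi u1 + pi u2)%R.
    have nM u := subsetP (normal_norm nsM) _ (FiniteModule.fmodP u).
    rewrite /pi FiniteModule.fmvalA morphM ?nM //=.
    by rewrite FiniteModule.fmodM ?mem_quotient ?FiniteModule.fmodP.
  have pi1 u : FiniteModule.fmval u \in M -> pi u = 0%R.
    by move=> Mu; rewrite /pi coset_id // FiniteModule.fmod1.
  have pB (w : FiniteModule.fmod_of abB) : (w *+ p = 0)%R.
    apply: FiniteModule.fmod_inj; rewrite FiniteModule.fmvalZ /= -[in LHS]indM.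
    by rewrite -card_quotient ?normal_norm // expg_cardG ?FiniteModule.fmodP.
  pose lam y := pi (phi y).
  have lamM : {in N &, forall y z, lam (y * z) = (lam y + lam z)%R}.
    by move=> y z Ny Nz; rewrite /lam phiM ?piM.
  have /subsetPn[_ /morphimP[y nKy Py ->] M'y] : ~~ (P / K \subset M).
    by rewrite defNK; apply: proper_subn; apply: maxgroupp maxM.
  have Ny := subsetP sPN y Py.
  have NKy : coset K y \in N / K by apply: mem_quotient.
  have nz_y : lam y != 0%R.
    apply: contra M'y => /eqP/(congr1 (@FiniteModule.fmval _ _ _)).
    rewrite /lam /pi /phi !FiniteModule.fmodK ?mem_quotient //.
    by apply: coset_idr; apply: (subsetP (normal_norm nsM)).
  have [x Px] := transfer_nonzero pB lamM Py nz_y; case/eqP.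
  have pi0 : pi 0%R = 0%R by apply: pi1; apply: group1.
  (* Transfer commutes with the additive map [pi]. *)
  rewrite -[csum _ _ _]/(\sum_(u in D) pi (coset_cocycle phi u x))%R.
  rewrite -(big_morph pi piM pi0) pi1 //; apply: (subsetP svM).
  by apply: (mem_morphim vm); rewrite ?(subsetP sPG).
have sG'v : P :&: G^`(1) \subset 'ker_P vm.
  have abvG : abelian (vm @* G).
    by apply: (abelianS _ abA); apply/subsetP=> _ /morphimP[g _ _ ->].
  rewrite setIS // ker_trivg_morphim der_sub.
  by rewrite morphim_der //= (derG1P abvG) subxx.
have sPN'G' : P :&: N^`(1) \subset P :&: G^`(1) by rewrite setIS ?dergS.
(* Both are kernels of maps from [P] onto [N / K]. *)
have cardK : #|P :&: K| = #|'ker_P vm|.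
  have iK : #|P : P :&: K| = #|P : 'ker_P vm|.
    have := card_morphim vm P; rewrite vP -defNK card_morphim ker_coset.
    by rewrite (setIidPr sPG) (setIidPr nKP) !indexgI.
  apply/eqP; rewrite -(eqn_pmul2r (indexg_gt0 P (P :&: K))) {2}iK.
  by rewrite !Lagrange ?subsetIl.
have sK : P :&: K \subset P :&: N^`(1) by rewrite subsetI subsetIl.
apply/eqP; rewrite eqEsubset sPN'G' andbT (subset_trans sG'v) //.
(* The chain from [P :&: K] through [P :&: N^](1)[and]P :&: G^[(1)] to the kernel collapses, since
   its ends have equal order. *)
suff /eqP <- : P :&: K == 'ker_P vm by [].
rewrite eqEcard cardK leqnn andbT.
exact: subset_trans sK (subset_trans sPN'G' sG'v).
Qed.

End FinalCount.

Theorem theorem1p1 (gT : finGroupType) (G P : {group gT}) (p : nat) :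
  prime p -> p.-Sylow(G) P -> weakly_closed (eta p P) P G ->
  P :&: G^`(1) = P :&: ('N_G(eta p P))^`(1).
Proof.
move=> p_pr sylP wcE.
exact: (@focal_normalizer gT p G P [group of eta p P] p_pr sylP
          (eta_powerfully_embedded p P) wcE).
Qed.
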